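(* For each deterministic algorithm $A$ for Metric $1$-median that makes $O(n)$ queries on $n$-point inputs, there is a sufficiently small constant $\delta>0$ such that $A$ is not $(\delta\log n)$-approximate; that is, it is not the case that on every $n$-point metric space $(M,d)$ the output $p$ of $A$ satisfies $\sum_{y\in M}d(p,y)\le\delta\log n\cdot\min_{q\in M}\sum_{y\in M}d(q,y)$.
   Context: Metric $1$-median: given an $n$-point metric space $(M,d)$ (the point set $M$ is known to the algorithm, while $d$ is accessible only through queries, each query asking for $d(x,y)$ for some $x,y\in M$, possibly chosen adaptively), output a point $p\in M$. An algorithm is $\gamma(n)$-approximate if on every $n$-point metric space its output $p$ satisfies $\sum_{y\in M}d(p,y)\le\gamma(n)\min_{q\in M}\sum_{y\in M}d(q,y)$. *)

(* Defs.v *)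
From HB Require Import structures.
From mathcomp Require Import all_boot all_order all_algebra.
From mathcomp Require Import all_classical all_reals all_analysis.

Set Implicit Arguments.
Unset Strict Implicit.
Unset Printing Implicit Defensive.

Import Order.TTheory GRing.Theory Num.Theory.
Local Open Scope ring_scope.

Definition is_metric (R : realType) (M : Type) (d : M -> M -> R) : Prop :=
  [/\ forall x y, 0 <= d x y,
      forall x y, d x y = 0 <-> x = y,
      forall x y, d x y = d y x &
      forall x y z, d x z <= d x y + d y z].

(* A deterministic adaptive algorithm on the fixed point set M: it either
   outputs a point, or queries a pair and continues according to the answer.
   No computability is required of the continuation. *)
Inductive query_tree (R : realType) (M : Type) : Type :=
| Output (p : M)
| Query (x y : M) (next : R -> query_tree R M).

Fixpoint output (R : realType) (M : Type) (t : query_tree R M)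
    (d : M -> M -> R) : M :=
  match t with
  | Output p => p
  | Query x y next => output (next (d x y)) d
  end.

Fixpoint num_queries (R : realType) (M : Type) (t : query_tree R M)
    (d : M -> M -> R) : nat :=
  match t with
  | Output _ => 0
  | Query x y next => (num_queries (next (d x y)) d).+1
  end.

(* The point set is part of the input. It must be assumed nonempty, since
   query_tree R M is empty when M is, and without the assumption there would
   be no algorithm at all. *)
Definition algorithm (R : realType) : Type :=
  forall M : finType, (0 < #|M|)%N -> query_tree R M.

Definition makes_linear_queries (R : realType) (A : algorithm R) : Prop :=
  exists C N : nat, forall (M : finType) (M_gt0 : (0 < #|M|)%N)
      (d : M -> M -> R),
    (N <= #|M|)%N -> is_metric d -> (num_queries (A M M_gt0) d <= C * #|M|)%N.

Definition cost (R : realType) (M : finType) (d : M -> M -> R) (p : M) : R :=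
  \sum_(y : M) d p y.

(* The seed of the iterated minimum is itself one of the costs, so this is the
   minimum of the costs over M, for any choice of p0. *)
Definition min_cost (R : realType) (M : finType) (d : M -> M -> R) (p0 : M)
  : R := \big[Num.min/cost d p0]_(q : M) cost d q.

(* The approximation guarantee at one given size n, with ratio c = gamma(n). *)
Definition approximate_at (R : realType) (A : algorithm R) (n : nat) (c : R)
  : Prop :=
  forall (M : finType) (M_gt0 : (0 < #|M|)%N) (d : M -> M -> R),
    #|M| = n -> is_metric d ->
    let p := output (A M M_gt0) d in cost d p <= c * min_cost d p.

(* Main.v *)
(** An adversary answers the queries while maintaining an integer metric [S],
    initially [L = Theta(log n)] between distinct points, and heights [h >= 1]
    that are 1-Lipschitz for [S]. The true distance is
    [min (S x y) (h x + h y)], as if a virtual hub lay at distance [h x] from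
    each [x]; hence the cheapest point costs at most [2 * sum h]. The query
    [(a, b)] is answered by this distance, which then becomes an edge of [S].
    No answer is altered later: heights only grow, and a new edge has length
    either [S a b], which changes nothing, or [h a + h b], and then by the
    Lipschitz condition a path through it from [x] to [y] has length at least
    [h x + h y].

    The height of [a] is raised by one (the raise spreading to other points by
    the Lipschitz condition) once [a] has received, at its current height [k],
    as many edges as there are points in the open ball of radius [k] around it.
    Only points of that ball are raised, so each query pays for O(1) of [sum h],
    and O(n) queries keep [sum h = O(n)]. On the other hand at most
    [#|ball a k|] edges were made at height [k], and they have length at least
    [k + 1], so ball sizes obey the Catalan recursion
    [N (r + 1) <= 1 + sum_k N k * N (r - k)] and grow at most like [4 ^ r].
    When the algorithm outputs [p], raising [p] to height [L] is therefore cheap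
    and puts most points at distance at least [L] from [p]. *)

Require Import Defs.
From HB Require Import structures.
From mathcomp Require Import all_boot all_order all_algebra.
From mathcomp Require Import all_classical all_reals all_analysis.
From mathcomp Require Import zify ring lra.

Import Order.TTheory GRing.Theory Num.Theory.

Set Implicit Arguments.
Unset Strict Implicit.
Unset Printing Implicit Defensive.

Local Open Scope nat_scope.

(** * States of the adversary *)

Record metric_height (M : finType) (S : M -> M -> nat) (h : M -> nat) : Prop :=
  MetricHeight {
    mh_refl : forall x, S x x = 0;
    mh_sep : forall x y, S x y = 0 -> x = y;
    mh_sym : forall x y, S x y = S y x;
    mh_tri : forall x y z, S x z <= S x y + S y z;
    mh_gt0 : forall x, 0 < h x;
    mh_lip : forall x y, h x <= h y + S x y }.

Definition oball (M : finType) (S : M -> M -> nat) (x : M) (r : nat) : {set M} :=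
  finset (fun y => S x y < r).

(* [G x k] is the set of points joined to [x] while the height of [x] was [k]. *)
Record adversary_state (M : finType) (L : nat) (S : M -> M -> nat)
    (h : M -> nat) (G : M -> nat -> {set M}) : Prop := AdversaryState {
  as_mh : metric_height S h;
  as_step : forall x y, x != y -> S x y < L ->
    exists k z, z \in G x k /\ S z y + k.+1 <= S x y;
  as_deg : forall x k, #|G x k| <= #|oball S x k|;
  as_fresh : forall x k, h x < k -> G x k = finset.set0 }.

(** * Raising heights *)

Definition raise (M : finType) (S : M -> M -> nat) (h : M -> nat) (z : M)
  (v : nat) (y : M) : nat := maxn (h y) (v - S z y).

Lemma raise_ge (M : finType) (S : M -> M -> nat) h z v y :
  h y <= raise S h z v y.
Proof. exact: leq_maxl. Qed.

Lemma metric_height_raise (M : finType) (S : M -> M -> nat) h z v :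
  metric_height S h -> metric_height S (raise S h z v).
Proof.
move=> [S0 Sp Ss St h0 hl]; split=> //.
  by move=> x; apply: leq_trans (h0 x) (raise_ge _ _ _ _ _).
move=> x y; have := hl x y; have := St z x y; rewrite /raise; lia.
Qed.

Lemma sum_raise (M : finType) (S : M -> M -> nat) h z v :
  \sum_y raise S h z v y <= \sum_y h y + v * #|oball S z v|.
Proof.
rewrite mulnC -sum_nat_const [X in _ + X]big_mkcond -big_split /=.
apply: leq_sum => y _; rewrite inE /raise; case: ifP; lia.
Qed.

(** The edges made at the current height are credit saved for the next raise. *)
Definition potential (M : finType) (h : M -> nat) (G : M -> nat -> {set M}) :=
  \sum_x (h x + #|G x (h x)|).

(** A raised point lies in the ball, rises by exactly one and has no edges at its new height. So the
    gain is at most the size of the ball, and [z] gives up at least that much credit. *)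
Lemma potential_raise (M : finType) L (S : M -> M -> nat) h G z :
  adversary_state L S h G -> #|oball S z (h z)| <= #|G z (h z)| ->
  potential (raise S h z (h z).+1) G <= potential h G.
Proof.
move=> [[S0 Sp Ss St h0 hl] _ _ Gf] full.
set h' := raise _ _ _ _.
suff: potential h' G + #|G z (h z)| <= potential h G + #|oball S z (h z)|.
  lia.
have eqG : #|G z (h z)| = \sum_y (y == z) * #|G z (h z)|.
  rewrite (bigD1 z) //= eqxx mul1n big1 ?addn0 // => y /negbTE -> //.
have eqB : #|oball S z (h z)| = \sum_y (y \in oball S z (h z)).
  by rewrite -sum1_card big_mkcond; apply: eq_bigr => y _; case: ifP.
rewrite [X in _ + X <= _]eqG eqB /potential -!big_split; apply: leq_sum => y _ /=.
have lip := hl z y; have := h0 y.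
rewrite inE; have [->|nyz] := eqVneq y z.
  have h'z : h' z = (h z).+1 by rewrite /h' /raise S0; lia.
  rewrite h'z (Gf z (h z).+1) // cards0 S0; lia.
have [h'y|h'y] := leqP (h' y) (h y).
  have -> : h' y = h y by apply/eqP; rewrite eqn_leq h'y raise_ge.
  lia.
rewrite (Gf y (h' y)) // cards0; move: h'y; rewrite /h' /raise; lia.
Qed.

(** * Adding an edge *)

(** The shortest-path metric after adding an edge of length [w], which a shortest path crosses at
    most once, in either direction. *)
Definition link (M : finType) (S : M -> M -> nat) (a b : M) (w : nat)
    (x y : M) : nat :=
  minn (S x y) (minn (S x a + w + S b y) (S x b + w + S a y)).

Lemma metric_height_link (M : finType) (S : M -> M -> nat) h a b w :
    metric_height S h -> (w = 0 -> a = b) -> h a <= h b + w -> h b <= h a + w ->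
  metric_height (link S a b w) h.
Proof.
move=> [S0 Sp Ss St h0 hl] w0 hab hba; split=> //.
- by move=> x; rewrite /link S0; lia.
- move=> x y; rewrite /link => E.
  have [/Sp //|[H|H]] : S x y = 0 \/ (S x a + w + S b y = 0 \/ S x b + w + S a y = 0) by lia.
    have /Sp -> : S x a = 0 by lia.
    have /Sp <- : S b y = 0 by lia.
    by apply: w0; lia.
  have /Sp -> : S x b = 0 by lia.
  have /Sp <- : S a y = 0 by lia.
  by apply/esym/w0; lia.
- move=> x y; rewrite /link.
  rewrite (Ss y x) (Ss y a) (Ss y b) (Ss a x) (Ss b x); lia.
- move=> x y z; rewrite /link.
  have := (St x y z, St x a z, St x b z, St x y a, St x y b, St a y z, St b y z).
  move=> [] [] [] [] [] [] *.
  rewrite (Ss y a) (Ss y b); move: (Ss y a) (Ss y b); lia.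
- move=> x y; rewrite /link.
  have := (hl x y, hl x a, hl x b, hl a y, hl b y).
  move=> [] [] [] [] *; lia.
Qed.

(* Answers already given are pairs on which [S] is at most the sum of heights;
   such pairs keep their distance. *)
Definition extends (M : finType) (S : M -> M -> nat) h (S' : M -> M -> nat) h' :=
  forall x y : M, S x y <= h x + h y ->
    S' x y = S x y /\ S' x y <= h' x + h' y.

Lemma extends_trans (M : finType) (S1 : M -> M -> nat) h1 S2 h2 S3 h3 :
  extends S1 h1 S2 h2 -> extends S2 h2 S3 h3 -> extends S1 h1 S3 h3.
Proof.
by move=> e12 e23 x y /e12 [<- /e23 []].
Qed.

Lemma extends_raise (M : finType) (S : M -> M -> nat) h z v :
  extends S h S (raise S h z v).
Proof.
move=> x y Sxy; split=> //; apply: leq_trans Sxy _.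
exact: leq_add (raise_ge _ _ _ _ _) (raise_ge _ _ _ _ _).
Qed.

Lemma extends_link (M : finType) (S : M -> M -> nat) h a b :
  metric_height S h ->
  extends S h (link S a b (minn (S a b) (h a + h b))) h.
Proof.
move=> [S0 Sp Ss St h0 hl] x y Sxy.
suff E : link S a b (minn (S a b) (h a + h b)) x y = S x y by rewrite E.
rewrite /link.
have := (St x a b, St x b y, St x b a, St x a y, hl x a, hl x b, hl y a, hl y b).
move=> [] [] [] [] [] [] [] *.
move: (Ss a b) (Ss y a) (Ss y b); lia.
Qed.

Definition add_link (M : finType) (h : M -> nat) (G : M -> nat -> {set M})
    (a b x : M) (k : nat) : {set M} :=
  if k == h x then
    if x == a then b |: G x k else if x == b then a |: G x k else G x k
  else G x k.

Lemma sub_add_link (M : finType) h (G : M -> nat -> {set M}) a b x k :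
  G x k \subset add_link h G a b x k.
Proof.
by rewrite /add_link; repeat case: ifP => _ //; apply: finset.subsetUr.
Qed.

Lemma card_add_link (M : finType) h (G : M -> nat -> {set M}) a b x k :
  #|add_link h G a b x k| <=
    #|G x k| + ((k == h x) && ((x == a) || (x == b))).
Proof.
rewrite /add_link; case: (k == h x) => //=; last by rewrite addn0.
by have [->|_] := eqVneq x a; [|have [->|_] := eqVneq x b];
  rewrite /= ?addn0 // cardsU1 addnC leq_add2l leq_b1.
Qed.

Lemma oball_link (M : finType) (S : M -> M -> nat) a b w x k :
  oball S x k \subset oball (link S a b w) x k.
Proof. by apply/fintype.subsetP => y; rewrite !inE /link; lia. Qed.

Lemma adversary_state_link (M : finType) L (S : M -> M -> nat) h G a b :
    adversary_state L S h G ->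
    #|G a (h a)| < #|oball S a (h a)| -> #|G b (h b)| < #|oball S b (h b)| ->
  adversary_state L (link S a b (minn (S a b) (h a + h b))) h
    (add_link h G a b).
Proof.
move=> [mh step deg fresh] da db; have [S0 Sp Ss St h0 hl] := mh.
set w := minn _ _; split.
- apply: metric_height_link => //.
  + by move=> w0; apply: Sp; have := h0 a; move: w0; rewrite /w; lia.
  + by have := hl a b; rewrite /w; lia.
  + by have := hl b a; rewrite (Ss b a) /w; lia.
- move=> x y nxy lt_L.
  have [le_S|lt_S] := leqP (S x y) (link S a b w x y).
    have eqS : link S a b w x y = S x y.
      by apply/eqP; rewrite eqn_leq le_S andbT geq_minl.
    have [|k [z [zG Sz]]] := step x y nxy; first by rewrite -eqS.
    exists k, z; split; first exact: (fintype.subsetP (sub_add_link _ _ _ _ _ _)).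
    by rewrite eqS; apply: leq_trans Sz; rewrite leq_add2r geq_minl.
  (* A shortest path now crosses the new edge from [u] to [v]. If [x] is [u], that edge is its first
     step, of length at least [h u + 1]; otherwise the old first step from [x] towards [u] still
     serves. *)
  have key u v : (u, v) = (a, b) \/ (u, v) = (b, a) ->
      link S a b w x y = S x u + w + S v y -> w = h u + h v ->
      exists k z, z \in add_link h G a b x k /\
        link S a b w z y + k.+1 <= link S a b w x y.
    move=> uv E wE; have le_z z : link S a b w z y <= S z u + w + S v y.
      by rewrite /link; case: uv => [] [-> ->]; lia.
    have [xu|nxu] := eqVneq x u.
      exists (h u), v; split.
        rewrite /add_link -xu eqxx xu.
        case: uv => [] [-> ->]; rewrite eqxx ?setU11 //.
        by have [->|_] := eqVneq b a; rewrite setU11.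
      rewrite E xu S0; have := h0 v.
      have : link S a b w v y <= S v y by exact: geq_minl.
      lia.
    have [|k [z [zG Sz]]] := step x u nxu; first by lia.
    exists k, z; split; first exact: (fintype.subsetP (sub_add_link _ _ _ _ _ _)).
    by rewrite E; have := le_z z; lia.
  (* With [w = S a b] the triangle inequality would rule out any shortening. *)
  have wE : w = h a + h b.
    have := (St x a y, St x b y, St a b y, St b a y) => [] [] [] [] *.
    by move: lt_S (Ss a b); rewrite /link /w; lia.
  have [E|E] : link S a b w x y = S x a + w + S b y \/
               link S a b w x y = S x b + w + S a y.
  + by move: lt_S; rewrite /link; lia.
  + by apply: (key a b) => //; left.
  + by apply: (key b a) => //; [right | rewrite addnC].
- move=> x k; apply: leq_trans (subset_leq_card (oball_link _ _ _ _ _ _)).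
  apply: leq_trans (card_add_link _ _ _ _ _ _) _.
  have [->|_] := eqVneq k (h x); last by rewrite addn0.
  have [->|_] := eqVneq x a; first by rewrite addn1.
  have [->|_] := eqVneq x b; first by rewrite addn1.
  by rewrite addn0.
- by move=> x k ltk; rewrite /add_link gtn_eqF // fresh.
Qed.

Lemma potential_add_link (M : finType) h (G : M -> nat -> {set M}) a b :
  potential h (add_link h G a b) <= potential h G + 2.
Proof.
have -> : 2 = \sum_(x : M) ((x == a) + (x == b)).
  rewrite big_split /=.
  have one c : \sum_(x : M) (x == c : nat) = 1.
    by rewrite (bigD1 c) //= eqxx big1 // => x /negbTE ->.
  by rewrite !one.
rewrite /potential -big_split; apply: leq_sum => x _ /=.
have := card_add_link h G a b x (h x); rewrite eqxx /=.
by case: (x == a); case: (x == b) => /=; lia.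
Qed.

(** * Answering one query *)

(** One raise suffices, since a raised point has no edges at its new height. The last conjunct keeps
    the room made for one endpoint while room is made for the other. *)
Lemma make_room (M : finType) L (S : M -> M -> nat) h G z :
    adversary_state L S h G ->
  exists h', [/\ adversary_state L S h' G, potential h' G <= potential h G,
    extends S h S h', #|G z (h' z)| < #|oball S z (h' z)| &
    forall x, #|G x (h x)| < #|oball S x (h x)| ->
      #|G x (h' x)| < #|oball S x (h' x)|].
Proof.
move=> st; have [lt|full] := ltnP #|G z (h z)| #|oball S z (h z)|.
  by exists h; split=> // x y.
have [mh step deg fresh] := st; set h' := raise S h z (h z).+1.
have mh' : metric_height S h' by apply: metric_height_raise.
have room x : h x < h' x -> #|G x (h' x)| < #|oball S x (h' x)|.
  move=> lt; rewrite fresh // cards0 card_gt0; apply/finset.set0Pn.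
  by exists x; rewrite inE (mh_refl mh') (mh_gt0 mh').
exists h'; split.
- split=> // x k ltk; apply: fresh; apply: leq_ltn_trans ltk.
  exact: raise_ge.
- exact: potential_raise st full.
- exact: extends_raise.
- by apply: room; rewrite /h' /raise (mh_refl mh); lia.
- move=> x ltx; have [->//|/room//] : h' x = h x \/ h x < h' x.
  by have := raise_ge S h z (h z).+1 x; rewrite -/h'; lia.
Qed.

Lemma answer_query (M : finType) L (S : M -> M -> nat) h G a b :
    adversary_state L S h G ->
  exists S' h' G', [/\ adversary_state L S' h' G',
    potential h' G' <= potential h G + 2,
    extends S h S' h' & S' a b <= h' a + h' b].
Proof.
move=> st.
have [h1 [st1 p1 e1 ra _]] := make_room a st.
have [h2 [st2 p2 e2 rb ra2]] := make_room b st1.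
have {}ra := ra2 a ra.
exists (link S a b (minn (S a b) (h2 a + h2 b))), h2, (add_link h2 G a b).
split.
- exact: adversary_state_link.
- apply: leq_trans (potential_add_link _ _ _ _) _; lia.
- apply: extends_trans e1 (extends_trans e2 _).
  exact/extends_link/(as_mh st2).
- rewrite /link (mh_refl (as_mh st2) a) (mh_refl (as_mh st2) b); lia.
Qed.

Local Open Scope ring_scope.

(** * The Catalan recursion and ball sizes *)

Lemma sum_convolution (R : comNzRingType) (u : nat -> R) r :
  \sum_(i < r) \sum_(k < i.+1) u k * u (i - k)%N =
  \sum_(k < r) u k * \sum_(j < r - k) u j.
Proof.
elim: r => [|r IH]; first by rewrite !big_ord0.
rewrite big_ord_recr /= IH [RHS]big_ord_recr /= subSnn big_ord1.
rewrite [X in _ + X]big_ord_recr /= subnn addrA -big_split /=; congr (_ + _).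
apply: eq_bigr => k _; rewrite -mulrDr; congr (_ * _).
by rewrite subSn 1?ltnW // big_ord_recr.
Qed.

(* The generating function of [N] is at most 1 at 1/4, because
   1/3 + 1^2/4 <= 1. *)
Lemma catalan_bound (N : nat -> nat) (L : nat) :
    N 0 = 0%N ->
    (forall r, r < L -> N r.+1 <= 1 + \sum_(k < r.+1) N k * N (r - k))%N ->
  forall r, (r <= L)%N -> (N r <= 4 ^ r)%N.
Proof.
move=> N0 rec; pose x : rat := 4%:R^-1; pose u i : rat := (N i)%:R * x ^+ i.
have x_ge0 : 0 <= x by rewrite /x invr_ge0 ler0n.
have u_ge0 i : 0 <= u i by rewrite mulr_ge0 ?exprn_ge0 ?ler0n.
have geo r : \sum_(i < r) x ^+ i.+1 <= 3%:R^-1.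
  suff -> : \sum_(i < r) x ^+ i.+1 = (1 - x ^+ r) / 3%:R.
    by have := exprn_ge0 r x_ge0; lra.
  elim: r => [|r IH]; first by rewrite big_ord0 expr0 subrr mul0r.
  by rewrite big_ord_recr /= IH exprS /x; field.
have T_le1 r : (r <= L.+1)%N -> \sum_(i < r) u i <= 1.
  elim/ltn_ind: r => [] [|r] IH rL; first by rewrite big_ord0.
  rewrite big_ord_recl /= {1}/u N0 mul0r add0r.
  have step (i : 'I_r) : true -> u (bump 0 i) <=
      x ^+ i.+1 + x * \sum_(k < i.+1) u k * u (i - k)%N.
    move=> _; rewrite /bump leq0n add1n.
    have := rec i (leq_trans (ltn_ord i) rL).
    rewrite -(ler_nat rat) natrD natr_sum => le_N.
    have := ler_wpM2r (exprn_ge0 i.+1 x_ge0) le_N; rewrite -/(u i.+1).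
    move/le_trans; apply; rewrite mulrDl mul1r lerD2l exprS mulrCA ler_wpM2l //.
    rewrite mulr_suml le_eqVlt; apply/orP; left; apply/eqP.
    apply: eq_bigr => k _; rewrite natrM /u mulrACA -exprD subnKC //.
    by rewrite -ltnS.
  apply: (le_trans (ler_sum _ step)).
  rewrite big_split /= -mulr_sumr sum_convolution.
  have le_conv : \sum_(k < r) u k * \sum_(j < r - k) u j <= 1.
    apply: le_trans (IH r (leqnn _) (ltnW rL)); apply: ler_sum => k _.
    rewrite ler_piMr // IH ?ltnS ?leq_subr //.
    exact: leq_trans (leq_subr _ _) (ltnW rL).
  have := geo r; have := ler_wpM2l x_ge0 le_conv; rewrite mulr1 {2}/x; lra.
move=> r rL; have : u r <= 1.
  apply: le_trans (T_le1 r.+1 rL); rewrite big_ord_recr /= lerDr.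
  by apply: sumr_ge0 => i _.
rewrite /u /x exprVn ler_pdivrMr ?exprn_gt0 // mul1r.
by rewrite -natrX ler_nat.
Qed.

(** By [as_step], each [y] other than [x] in the ball of radius [r + 1] lies within the ball of
    radius [r - k] around some point of [G x k], and [as_deg] bounds the number of such points. The
    maximum over centres closes the recursion. *)
Lemma card_oball (M : finType) L (S : M -> M -> nat) h G x r :
  adversary_state L S h G -> (r <= L)%N -> (#|oball S x r| <= 4 ^ r)%N.
Proof.
move=> [[S0 Sp Ss St h0 hl] step deg fresh].
pose N r := (\max_x #|oball S x r|)%N.
have le_N y k : (#|oball S y k| <= N k)%N by exact: leq_bigmax.
move=> rL; apply: leq_trans (le_N x r) _; move: r rL.
apply: catalan_bound => [|r rL].
  rewrite /N big1 // => y _; apply/eqP; rewrite cards_eq0; apply/eqP/setP => z.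
  by rewrite !inE ltn0.
apply/bigmax_leqP => {}x _.
have cardE (A : {set M}) : #|A| = (\sum_y (y \in A))%N.
  by rewrite -sum1_card big_mkcond; apply: eq_bigr => y _; case: ifP.
have -> : (1 + \sum_(k < r.+1) N k * N (r - k) =
    \sum_(y in [set x]%SET) 1 + \sum_(k < r.+1) N k * N (r - k))%N.
  by rewrite sum1_card cards1.
apply: (@leq_trans (\sum_y ((y == x) +
    \sum_(k < r.+1) \sum_(z in G x k) (y \in oball S z (r - k))))%N).
  rewrite cardE; apply: leq_sum => y _; rewrite inE.
  have [ltS|//] := boolP (S x y < r.+1)%N.
  have [->|nyx] := eqVneq y x; first by [].
  have [||k [z [zG Sz]]] := step x y; first by rewrite eq_sym.
    exact: leq_trans ltS rL.
  have kr : (k < r.+1)%N by lia.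
  rewrite (bigD1 (Ordinal kr)) //= (bigD1 z) //= inE.
  by have -> : (S z y < r - k)%N by lia.
rewrite big_split /= leq_add //.
  by rewrite [X in (_ <= X)%N]big_mkcond; apply: leq_sum => y _; rewrite inE; case: eqP.
rewrite exchange_big; apply: leq_sum => k _ /=; rewrite exchange_big /=.
apply: leq_trans (leq_mul (leq_trans (deg x k) (le_N x k)) (leqnn _)).
rewrite -sum_nat_const; apply: leq_sum => z _.
by rewrite -cardE.
Qed.

(** * The hub metric and the run of the algorithm *)

Definition hub_dist (R : realType) (M : finType) (S : M -> M -> nat)
    (h : M -> nat) (x y : M) : R := (minn (S x y) (h x + h y))%:R.

Lemma is_metric_hub_dist (R : realType) (M : finType) (S : M -> M -> nat) h :
  metric_height S h -> is_metric (@hub_dist R M S h).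
Proof.
move=> [S0 Sp Ss St h0 hl]; split.
- by move=> x y; rewrite ler0n.
- move=> x y; split=> [/eqP|->]; last by rewrite /hub_dist S0 min0n.
  by rewrite pnatr_eq0 => /eqP H; apply: Sp; have := h0 x; lia.
- by move=> x y; rewrite /hub_dist Ss addnC.
- move=> x y z; rewrite /hub_dist -natrD ler_nat.
  have := (St x y z, hl x y, hl z y) => [] [] [].
  by rewrite (Ss z y); lia.
Qed.

Lemma adversary_run (R : realType) (M : finType) L (t : query_tree R M) :
  forall (S : M -> M -> nat) h G, adversary_state L S h G ->
  exists S' h', let d := hub_dist R S' h' in let p := output t d in
    [/\ metric_height S' h', extends S h S' h', (L <= h' p)%N,
        (#|oball S' p L| <= 4 ^ L)%N &
        (\sum_x h' x <= potential h G + 2 * num_queries t d + L * 4 ^ L)%N].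
Proof.
elim: t => [p|a b next IH] S h G st.
  (* The final raise lifts only the at most [4 ^ L] points of the ball around [p], each by at most
     [L]. *)
  exists S, (raise S h p L); split=> /=.
  - exact/metric_height_raise/(as_mh st).
  - exact: extends_raise.
  - by rewrite /raise (mh_refl (as_mh st)) subn0 leq_maxr.
  - exact: card_oball st (leqnn L).
  - apply: leq_trans (sum_raise _ _ _ _) _; rewrite muln0 addn0.
    apply: leq_add; first by apply: leq_sum => x _; exact: leq_addr.
    by rewrite leq_mul2l (card_oball _ st) ?orbT.
have [S1 [h1 [G1 [st1 p1 e1 le1]]]] := answer_query a b st.
have [S' [h' []]] := IH (S1 a b)%:R S1 h1 G1 st1.
set d := hub_dist R S' h' => mh' e' Lh' card' sum'; exists S', h'.
(* The final metric still gives the recorded answer, so the run under [d] follows the same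
   branch. *)
have dab : d a b = (S1 a b)%:R.
  by have [<- /minn_idPl le'] := e' a b le1; rewrite /d /hub_dist le'.
rewrite /= -/d dab; split=> //; first exact: extends_trans e1 e'.
by apply: leq_trans sum' _; lia.
Qed.

Lemma adversary_state_init (M : finType) L : (0 < L)%N ->
  @adversary_state M L (fun x y => if x == y then 0%N else L) (fun=> 1%N)
    (fun _ _ => finset.set0).
Proof.
move=> L0; split; last by [].
- split=> //.
  + by move=> x; rewrite eqxx.
  + by move=> x y; case: eqP => // _ L0'; rewrite L0' in L0.
  + by move=> x y; rewrite eq_sym.
  + move=> x y z; have [->|_] := eqVneq x y; first by [].
    by case: (x == z); rewrite ?leq_addr.
- by move=> x y /negbTE ->; rewrite ltnn.
- by move=> x k; rewrite cards0.
Qed.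

(** * Costs and the approximation ratio *)

Lemma min_cost_le (R : realType) (M : finType) (d : M -> M -> R) p q :
  min_cost d p <= cost d q.
Proof. exact: bigmin_le_cond. Qed.

(** The minimum is at most the average of all costs. *)
Lemma min_cost_hub_dist (R : realType) (M : finType) (S : M -> M -> nat) h p :
  min_cost (hub_dist R S h) p <= (2 * \sum_x h x)%N%:R.
Proof.
have n0 : 0 < #|M|%:R :> R by rewrite ltr0n; apply/card_gt0P; exists p.
rewrite -(ler_pM2l n0) -natrM mulr_natl.
rewrite -sumr_const; apply: (@le_trans _ _ (\sum_q cost (hub_dist R S h) q)).
  by apply: ler_sum => q _; exact: min_cost_le.
have -> : \sum_q cost (hub_dist R S h) q =
    (\sum_q \sum_y minn (S q y) (h q + h y))%N%:R.
  by rewrite natr_sum; apply: eq_bigr => q _; rewrite natr_sum.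
rewrite ler_nat.
apply: (@leq_trans (\sum_q \sum_y (h q + h y))%N).
  by apply: leq_sum => q _; apply: leq_sum => y _; exact: geq_minr.
under eq_bigr => q _ do rewrite big_split /= sum_nat_const.
by rewrite big_split /= -big_distrr /= sum_nat_const mulnCA mul2n -addnn.
Qed.

Lemma cost_hub_dist (R : realType) (M : finType) (S : M -> M -> nat) h p L :
  (L <= h p)%N -> (L * (#|M| - #|oball S p L|))%N%:R <= cost (hub_dist R S h) p.
Proof.
move=> Lh; rewrite /cost /hub_dist -natr_sum ler_nat.
rewrite -{1}[oball S p L]finset.setCK -cardsCs.
rewrite mulnC -sum_nat_const big_mkcond; apply: leq_sum => y _.
by rewrite !inE; case: ifP; lia.
Qed.

Lemma cost_gt0 (R : realType) (M : finType) (d : M -> M -> R) p :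
  is_metric d -> (1 < #|M|)%N -> 0 < cost d p.
Proof.
move=> [d0 d1 _ _] /card_gt1P [x [y [_ _ nxy]]].
have [q npq] : exists q, p != q.
  by have [->|] := eqVneq p x; [exists y | exists x].
rewrite /cost (bigD1 q) //= ltr_pwDl ?sumr_ge0 // lt_neqAle d0 andbT eq_sym.
by apply: contra npq => /eqP /d1 ->.
Qed.

Lemma adversary_ratio (R : realType) (M : finType) (t : query_tree R M) C :
    (7 < #|M|)%N ->
    (forall d, is_metric d -> (num_queries t d <= C * #|M|)%N) ->
  exists2 d : M -> M -> R, is_metric d &
    let p := output t d in
    (trunc_log 8 #|M|)%:R * min_cost d p <= (8 * (1 + C))%:R * cost d p.
Proof.
set n := #|M|; set L := trunc_log 8 n => n8 lin.
have L0 : (0 < L)%N by rewrite trunc_log_gt0.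
have Ln : (8 ^ L <= n)%N by apply: trunc_logP => //; apply: leq_trans n8.
have [S [h []]] := adversary_run t (adversary_state_init M L0).
set d := hub_dist R S h; set p := output t d => mh _ Lh card sum.
have met : is_metric d by apply: is_metric_hub_dist.
exists d => //=; rewrite -/p; have {}lin := lin d met.
(* Base 8 leaves a factor [2 ^ L] to spare over [4 ^ L]: the final raise costs at most [n], and at
   least half of the points stay outside the ball. *)
have E8 : (8 ^ L = 2 ^ L * 4 ^ L)%N by rewrite -expnMn.
have L2 : (L < 2 ^ L)%N by apply: ltn_expl.
have L4 : (L * 4 ^ L <= n)%N.
  by apply: leq_trans Ln; rewrite E8 leq_mul2r ltnW ?orbT.
have half : (2 * 4 ^ L <= n)%N.
  by apply: leq_trans Ln; rewrite E8 leq_mul2r (leq_ltn_trans L0 L2) orbT.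
have pot : potential (fun _ : M => 1%N) (fun _ _ => finset.set0) = n.
  rewrite /potential; under eq_bigr do rewrite cards0 addn0.
  by rewrite sum1_card.
have sum_h : (\sum_x h x <= 2 * (1 + C) * n)%N.
  by apply: leq_trans sum _; rewrite pot; lia.
have le_cost := cost_hub_dist R S Lh; rewrite -/d -/n in le_cost.
(* The minimum is at most [4 * (1 + C) * n] and the cost of [p] at least [L * n / 2]. *)
apply: (@le_trans _ _ (L * (4 * (1 + C) * n))%:R).
  rewrite natrM ler_wpM2l // (le_trans (min_cost_hub_dist _ _ _ _)) // ler_nat.
  by lia.
apply: le_trans (ler_wpM2l (ler0n _ _) le_cost).
rewrite -natrM ler_nat.
have : (n <= 2 * (n - #|oball S p L|))%N by lia.
by move=> H; have := leq_mul (leqnn (L * (4 * (1 + C)))) H; lia.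
Qed.

Local Close Scope nat_scope.
Local Open Scope ring_scope.
Unset Implicit Arguments.

Theorem theorem18 (R : realType) (A : algorithm R)
    (A_linear : makes_linear_queries A) :
  exists delta : R, 0 < delta /\
    forall n : nat, (2 <= n)%N -> ~ approximate_at A n (delta * ln n%:R).
Proof.
have [C [N lin]] := A_linear.
pose l8 : R := ln 8%:R; pose lN : R := ln (N + 8)%:R.
have l8_gt0 : 0 < l8 by rewrite ln_gt0 // ltr1n.
have lN_gt0 : 0 < lN by rewrite ln_gt0 // ltr1n; lia.
pose K : R := (8 * (1 + C))%:R.
have K_gt0 : 0 < K by rewrite ltr0n.
(* The first term of [D] serves large [n]; [lN] makes the claimed ratio less than 1 for
   [n < N + 8]. *)
pose D : R := 4%:R * l8 * K + lN.
have D_gt0 : 0 < D by rewrite addr_gt0 // !mulr_gt0.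
have D_ge : 4%:R * l8 * K < D /\ lN <= D.
  by split; rewrite /D ?ltrDl // lerDr !mulr_ge0 // ltW.
exists (2%:R^-1 / D); split; first by rewrite divr_gt0.
move=> n n2 approx.
have M_gt0 : (0 < #|'I_n|)%N by rewrite card_ord ltnW.
have lnn_ge0 : 0 <= ln n%:R :> R by rewrite ln_ge0 // ler1n ltnW.
have [nN|nN] := ltnP n (N + 8).
  (* Here any metric refutes a ratio below 1; this one has all nonzero distances 1. *)
  have met := is_metric_hub_dist R (as_mh (adversary_state_init 'I_n (ltnSn 0))).
  have := approx _ M_gt0 _ (card_ord n) met.
  set d := hub_dist _ _ _; set p := output _ _ => /= le_c.
  have c_gt0 : 0 < cost d p by apply: cost_gt0 => //; rewrite card_ord.
  have lt1 : 2%:R^-1 / D * ln n%:R < 1.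
    have le_ln : ln n%:R <= lN.
      by rewrite ler_ln ?posrE ?ltr0n ?ler_nat; lia.
    rewrite mulrAC ltr_pdivrMr // mul1r; have [_] := D_ge; lra.
  have c_ge0 : 0 <= 2%:R^-1 / D * ln n%:R by rewrite mulr_ge0 // divr_ge0 // ltW.
  have := le_trans le_c (ler_wpM2l c_ge0 (min_cost_le d p p)).
  by rewrite ler_pMl // leNgt lt1.
have n8 : (7 < #|'I_n|)%N by rewrite card_ord; lia.
have linA d : is_metric d -> (num_queries (A _ M_gt0) d <= C * #|'I_n|)%N.
  by apply: lin; rewrite card_ord; lia.
have [d met] := adversary_ratio n8 linA; have := approx _ M_gt0 _ (card_ord n) met.
rewrite /= -/K card_ord; set p := output _ _; set L := trunc_log 8 n => le_c le_L.
have c_gt0 : 0 < cost d p by apply: cost_gt0 => //; rewrite card_ord.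
have L_gt0 : (0 < L)%N by rewrite trunc_log_gt0; lia.
(* Since [L] is positive, [n < 8 ^ (L + 1) <= 8 ^ (2 * L)]. *)
have le_ln : ln n%:R <= l8 * (2 * L)%:R.
  have -> : l8 * (2 * L)%:R = ln (8 ^ (2 * L))%:R by rewrite natrX lnXn // mulr_natr.
  rewrite ler_ln ?posrE ?ltr0n ?expn_gt0 ?(ltnW n2) // ler_nat.
  apply: ltnW; apply: (leq_trans (trunc_log_ltn n (isT : 1 < 8)%N)).
  by rewrite leq_exp2l //; lia.
have min_ge0 : 0 <= min_cost d p.
  by apply: le_bigmin => [|q _]; apply: ltW; apply: cost_gt0 => //; rewrite card_ord.
have [D_gt _] := D_ge.
(* cost <= (ln n / 2D) min <= (l8 L / D) min <= (l8 K / D) cost < cost *)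
have H1 : D * cost d p <= l8 * (L%:R * min_cost d p).
  have := ler_wpM2l (ltW D_gt0) le_c.
  have -> : D * (2%:R^-1 / D * ln n%:R * min_cost d p) =
      2%:R^-1 * (ln n%:R * min_cost d p) by field; rewrite gt_eqF.
  have := ler_wpM2r min_ge0 le_ln; rewrite natrM; lra.
have H2 := ler_wpM2l (ltW l8_gt0) le_L.
have H3 : D * cost d p <= l8 * K * cost d p by rewrite -mulrA (le_trans H1).
move: H3; rewrite ler_pM2r // leNgt => /negP; apply.
apply: le_lt_trans D_gt; have : 0 <= l8 * K by rewrite mulr_ge0 // ltW.
by lra.
Qed.
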